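(* Let $A, B$ be positive definite matrices and let $C, D$ be positive semidefinite matrices, all of the same size $n \times n$. Then $$\mathrm{Tr}\left[(A-B)(B^{-1}-A^{-1})+4(C-D)\left\{(B+D)^{-1}-(A+C)^{-1}\right\}\right]\geq 0.$$
   Context: All matrices are complex $n\times n$ matrices; positive definite and positive semidefinite matrices are in particular Hermitian. $\mathrm{Tr}$ denotes the usual (unnormalized) matrix trace. An inequality $\mathrm{Tr}[\cdot] \ge 0$ is understood to mean that the trace is a real number and is nonnegative. *)

(* Defs.v *)
From mathcomp Require Import all_boot all_order all_algebra.
From mathcomp Require Import reals.
From mathcomp Require Import complex.

Set Implicit Arguments.
Unset Strict Implicit.
Unset Printing Implicit Defensive.

Import Order.TTheory GRing.Theory Num.Theory.
Local Open Scope ring_scope.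
Local Open Scope sesquilinear_scope.

(* In a numClosedFieldType, [0 <= z] and [0 < z] entail that z is real, so the
   order conditions below include the realness of the quadratic form. *)
Definition posdefmx (K : numClosedFieldType) (n : nat) (A : 'M[K]_n) : Prop :=
  A \is hermsymmx /\
  forall v : 'cV[K]_n, v != 0 -> 0 < (v ^t* *m A *m v) 0 0.

Definition possemidefmx (K : numClosedFieldType) (n : nat) (A : 'M[K]_n) :
    Prop :=
  A \is hermsymmx /\
  forall v : 'cV[K]_n, 0 <= (v ^t* *m A *m v) 0 0.

(* Main.v *)
Require Import Defs.
From mathcomp Require Import all_boot all_order all_algebra.
From mathcomp Require Import reals complex.
From mathcomp Require Import ring.

(** Why the inequality holds. Put P = A + C, Q = B + D, X = A - B, Y = P - Q, so
    that C - D = Y - X, and write a, b, p, q for the inverses of A, B, P, Q. The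
    identity B^-1 - A^-1 = A^-1 (A - B) B^-1 turns the left-hand side into

      tr (X a X b) + 4 tr ((Y - X) p Y q).

    Adding a positive semidefinite matrix to a positive definite one decreases
    its inverse, so a - p and b - q are positive semidefinite
    ([possemidefmx_invB]). As the form tr (X M X N) is monotone in M and N
    ([mxtrace_sandwich_le]), tr (X a X b) >= tr (X p X q), and what remains is

      tr (X p X q) - 4 tr (X p Y q) + 4 tr (Y p Y q)
        = tr ((X - 2 Y) p (X - 2 Y) q) >= 0.

    The completed square ([mxtrace_sandwich_square]) needs the two cross terms
    tr (X p Y q) and tr (Y p X q) to agree; they do because p Y q and q Y p are
    both equal to q - p.

    All positivity comes down to the trace of a product of two positive
    semidefinite matrices being nonnegative
    ([mxtrace_mul_possemidef_ge0]). *)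

Set Implicit Arguments.
Unset Strict Implicit.
Unset Printing Implicit Defensive.

Import Order.TTheory GRing.Theory Num.Theory.
Local Open Scope ring_scope.
Local Open Scope complex_scope.
Local Open Scope sesquilinear_scope.

Section PositiveMatrices.
Variables (K : numClosedFieldType) (n : nat).
Implicit Types A B C D M N P X Y : 'M[K]_n.

Lemma hermsymmxE A : (A \is hermsymmx) = (A == A ^t*).
Proof. by rewrite qualifE /= expr0 scale1r. Qed.

Lemma trmxC_mul (m p r : nat) (U : 'M[K]_(m, p)) (V : 'M[K]_(p, r)) :
  (U *m V) ^t* = V ^t* *m U ^t*.
Proof. by rewrite trmx_mul map_mxM. Qed.

Lemma trmxC_inv A : (invmx A) ^t* = invmx (A ^t*).
Proof. by rewrite trmx_inv map_invmx. Qed.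

Lemma hermsymmxD A B :
  A \is hermsymmx -> B \is hermsymmx -> A + B \is hermsymmx.
Proof.
rewrite !hermsymmxE => /eqP hA /eqP hB.
by rewrite linearD map_mxD /= -hA -hB.
Qed.

Lemma hermsymmxZ_nat (k : nat) A :
  A \is hermsymmx -> k%:R *: A \is hermsymmx.
Proof.
rewrite !hermsymmxE => /eqP hA.
by rewrite linearZ map_mxZ /= rmorph_nat -hA.
Qed.

Lemma hermsymmxB A B :
  A \is hermsymmx -> B \is hermsymmx -> A - B \is hermsymmx.
Proof.
rewrite !hermsymmxE => /eqP hA /eqP hB.
by rewrite linearB map_mxB /= -hA -hB.
Qed.

Lemma hermsymmx_inv A : A \is hermsymmx -> invmx A \is hermsymmx.
Proof. by rewrite !hermsymmxE trmxC_inv => /eqP <-. Qed.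

Lemma possemidefmxD M N :
  possemidefmx M -> possemidefmx N -> possemidefmx (M + N).
Proof.
move=> [hM M0] [hN N0]; split=> [|v]; first exact: hermsymmxD.
by rewrite mulmxDr mulmxDl mxE addr_ge0.
Qed.

Lemma possemidefmx_congr M P :
  possemidefmx M -> possemidefmx (P ^t* *m M *m P).
Proof.
move=> [hM M0]; split=> [|v].
  move: hM; rewrite !hermsymmxE => /eqP hM.
  by rewrite !trmxC_mul trmxCK -hM mulmxA.
by have := M0 (P *m v); rewrite trmxC_mul !mulmxA.
Qed.

Lemma possemidefmx_hermcongr M P : P \is hermsymmx ->
  possemidefmx M -> possemidefmx (P *m M *m P).
Proof.
by rewrite hermsymmxE => /eqP hP /(possemidefmx_congr P); rewrite -hP.
Qed.

(** A diagonal entry is the value of the quadratic form at a basis vector. *)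
Lemma possemidefmx_diag_ge0 M i : possemidefmx M -> 0 <= M i i.
Proof.
move=> [_ /(_ (delta_mx i 0))].
by rewrite trmx_delta map_delta_mx -rowE -colE !mxE.
Qed.

(** In an orthonormal eigenbasis of [M] the trace becomes the sum of the
    eigenvalues of [M] weighted by the diagonal entries of [N], and all of these
    numbers are nonnegative. *)
Lemma mxtrace_mul_possemidef_ge0 M N :
  possemidefmx M -> possemidefmx N -> 0 <= \tr (M *m N).
Proof.
move=> hM hN.
have /hermitian_normalmx/orthomx_spectralP eqM := hM.1.
set P := spectralmx M in eqM; set d := spectral_diag M in eqM.
have uP : P \in unitmx by exact: spectral_unit.
have eP : invmx P = P ^t* by exact/invmx_unitary/spectral_unitarymx.
have eqd : diag_mx d = (P ^t*) ^t* *m M *m P ^t*.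
  by rewrite trmxCK -eP eqM !mulmxA mulmxV // mul1mx mulmxK.
have d0 i : 0 <= d 0 i.
  have := possemidefmx_diag_ge0 i (possemidefmx_congr (P ^t*) hM).
  by rewrite -eqd mxE eqxx mulr1n.
rewrite eqM -!mulmxA mxtrace_mulC eP -!mulmxA.
have hPN := possemidefmx_congr (P ^t*) hN; rewrite trmxCK in hPN.
rewrite [P *m (N *m _)]mulmxA mul_diag_mx.
apply: sumr_ge0 => i _; rewrite mxE mulr_ge0 //.
exact: possemidefmx_diag_ge0.
Qed.

Lemma mxtrace_sandwich_ge0 M N X : X \is hermsymmx ->
  possemidefmx M -> possemidefmx N -> 0 <= \tr (X *m M *m X *m N).
Proof.
by move=> hX hM hN; apply/mxtrace_mul_possemidef_ge0/hN/possemidefmx_hermcongr.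
Qed.

(** Changing the two weights one at a time writes the difference as a sum of two
    sandwiches, with weights ([M' - M], [N']) and ([M], [N' - N]). *)
Lemma mxtrace_sandwich_le M M' N N' X : X \is hermsymmx ->
    possemidefmx M -> possemidefmx (M' - M) ->
    possemidefmx N' -> possemidefmx (N' - N) ->
  \tr (X *m M *m X *m N) <= \tr (X *m M' *m X *m N').
Proof.
move=> hX hM hMM' hN' hNN'; rewrite -subr_ge0.
suff -> : \tr (X *m M' *m X *m N') - \tr (X *m M *m X *m N) =
    \tr (X *m (M' - M) *m X *m N') + \tr (X *m M *m X *m (N' - N)).
  by apply: addr_ge0; exact: mxtrace_sandwich_ge0.
rewrite mulmxBr !mulmxBl mulmxBr !linearB /=; ring.
Qed.

(** On a kernel vector the quadratic form would vanish. *)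
Lemma posdefmx_unit A : posdefmx A -> A \in unitmx.
Proof.
move=> [_ A0]; rewrite -unitmx_tr -row_free_unit -kermx_eq0.
apply/rowV0P => v /sub_kermxP vA; apply/eqP/contraT => v0.
have /A0 : v^T != 0 by rewrite trmx_eq0.
by rewrite -mulmxA -[A]trmxK -trmx_mul vA trmx0 mulmx0 mxE ltxx.
Qed.

Lemma posdefmxW A : posdefmx A -> possemidefmx A.
Proof.
move=> [hA A0]; split=> // v; have [->|/A0/ltW //] := eqVneq v 0.
by rewrite mulmx0 mxE.
Qed.

Lemma posdefmxD A C : posdefmx A -> possemidefmx C -> posdefmx (A + C).
Proof.
move=> [hA A0] [hC C0]; split=> [|v v0]; first exact: hermsymmxD.
by rewrite mulmxDr mulmxDl mxE ltr_wpDr // A0.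
Qed.

(** The inverse is congruent to [A]: A^-1 = A^-1 A A^-1. *)
Lemma possemidefmx_inv A : posdefmx A -> possemidefmx (invmx A).
Proof.
move=> hA; rewrite -[invmx A]mulmx1 -(mulmxV (posdefmx_unit hA)) mulmxA.
by apply: possemidefmx_hermcongr; [exact/hermsymmx_inv/hA.1 | exact: posdefmxW].
Qed.

Lemma invmxB A B : A \in unitmx -> B \in unitmx ->
  invmx B - invmx A = invmx A *m (A - B) *m invmx B.
Proof.
by move=> uA uB; rewrite mulmxBr mulmxBl mulVmx // mul1mx mulmxK.
Qed.

(** Antitonicity of the inverse. With a = A^-1 and p = (A + C)^-1, both
    a - p = p C a and a - p = a C p hold; substituting the second, in the form
    a = p + a C p, into the first gives a - p = p C p + p C a C p, a sum of
    congruences of C and of a. This avoids square roots of matrices. *)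
Lemma possemidefmx_invB A C : posdefmx A -> possemidefmx C ->
  possemidefmx (invmx A - invmx (A + C)).
Proof.
move=> hA hC; have hP := posdefmxD hA hC.
have uA := posdefmx_unit hA; have uP := posdefmx_unit hP.
have eC : A + C - A = C by rewrite addrC addKr.
set a := invmx A; set p := invmx (A + C).
have e1 : a - p = p *m C *m a by rewrite /a /p invmxB // eC.
have e2 : a - p = a *m C *m p.
  by rewrite /a /p -opprB invmxB // -mulNmx -mulmxN opprB eC.
have -> : a - p = p *m C *m p + p *m (C *m a *m C) *m p.
  rewrite e1 -[a in LHS](subrK p) e2 addrC mulmxDr.
  by rewrite !mulmxA.
have hp : p \is hermsymmx by exact/hermsymmx_inv/hP.1.
apply: possemidefmxD; first exact: possemidefmx_hermcongr.
do 2![apply: possemidefmx_hermcongr => //]; first exact: hC.1.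
exact: possemidefmx_inv.
Qed.

(** The hypothesis makes the two cross terms of the square have equal traces. *)
Lemma mxtrace_sandwich_square X Y p q : p *m Y *m q = q *m Y *m p ->
  \tr ((X - 2%:R *: Y) *m p *m (X - 2%:R *: Y) *m q)
  = \tr (X *m p *m X *m q) + 4%:R * \tr ((Y - X) *m (p *m Y *m q)).
Proof.
move=> pYq.
have swap : \tr (Y *m p *m X *m q) = \tr (X *m p *m Y *m q).
  by rewrite -mulmxA mxtrace_mulC -!mulmxA [p *m _]mulmxA pYq !mulmxA.
rewrite !(mulmxBl, mulmxBr) -!(scalemxAl, scalemxAr) !linearB /= !linearZ /=.
rewrite !mulmxA swap; ring.
Qed.

(** The inequality over any algebraically closed numeric field, where the
    spectral theorem for Hermitian matrices is available. *)
Lemma mxtrace_inv_perturbation_ge0 A B C D :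
    posdefmx A -> posdefmx B -> possemidefmx C -> possemidefmx D ->
  0 <= \tr ((A - B) *m (invmx B - invmx A)
            + 4%:R *: ((C - D) *m (invmx (B + D) - invmx (A + C)))).
Proof.
move=> hA hB hC hD.
have [hP hQ] := (posdefmxD hA hC, posdefmxD hB hD).
have [uP uQ] := (posdefmx_unit hP, posdefmx_unit hQ).
set X := A - B; pose Y := (A + C) - (B + D).
have -> : C - D = Y - X by rewrite /Y opprD addrACA -/X [RHS]addrC addKr.
rewrite invmxB ?posdefmx_unit // (invmxB uP uQ) -/X -/Y.
set a := invmx A; set b := invmx B.
set p := invmx (A + C); set q := invmx (B + D).
(* Both sides are q - p, by the difference formula read in the two orders. *)
have pYq : p *m Y *m q = q *m Y *m p.
  by rewrite -[Y in RHS]opprB mulmxN mulNmx -!invmxB // opprB.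
have hX : X \is hermsymmx by apply: hermsymmxB; [exact: hA.1 | exact: hB.1].
have hY : Y \is hermsymmx by apply: hermsymmxB; [exact: hP.1 | exact: hQ.1].
have hp : possemidefmx p by exact: possemidefmx_inv.
have le_pq : \tr (X *m p *m X *m q) <= \tr (X *m a *m X *m b).
  by apply: mxtrace_sandwich_le => //;
    [exact: possemidefmx_invB | exact: possemidefmx_inv | exact: possemidefmx_invB].
have sq0 : 0 <= \tr ((X - 2%:R *: Y) *m p *m (X - 2%:R *: Y) *m q).
  apply: mxtrace_sandwich_ge0 => //; last exact: possemidefmx_inv.
  exact/hermsymmxB/hermsymmxZ_nat.
rewrite linearD linearZ /=.
apply: le_trans sq0 _; rewrite mxtrace_sandwich_square // !mulmxA lerD2r.
exact: le_pq.
Qed.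

End PositiveMatrices.

Theorem theorem3p1 (R : realType) (n : nat) (A B C D : 'M[R[i]]_n)
  (hA : posdefmx A) (hB : posdefmx B)
  (hC : possemidefmx C) (hD : possemidefmx D) :
  0 <= \tr ((A - B) *m (invmx B - invmx A)
            + 4%:R *: ((C - D) *m (invmx (B + D) - invmx (A + C)))).
Proof. exact: mxtrace_inv_perturbation_ge0. Qed.
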